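(* Suppose that the trajectory set $\mathcal{S}$ is trajectorially complete and that the following condition holds: if $(S,j)$ is an arbitrage node of type II, then $j\ge1$, $(S,j-1)$ is an up-down node, and for every $\epsilon>0$ there are $S^{\epsilon,1},S^{\epsilon,2}\in\mathcal{S}_{(S,j-1)}$ such that $$S^{\epsilon,1}_j-S_{j-1}\ge-\epsilon,\qquad S^{\epsilon,2}_j-S_{j-1}\le\epsilon$$ and such that $(S^{\epsilon,1},j)$ and $(S^{\epsilon,2},j)$ are not type II arbitrage nodes. Then Assumption $(L)$-a.e. holds. More precisely, $(L_{(S,j)})$ fails at a node $(S,j)$ if and only if $(S,j)$ is an arbitrage node of type II.
   Context: Trajectories and nodes. Fix $s_0\in\mathbb{R}$ and a trajectory set $\mathcal{S}$, i.e. a set of real sequences $S=(S_i)_{i\ge 0}$ with $S_0=s_0$. For $S\in\mathcal{S}$ and $j\ge 0$ let $\mathcal{S}_{(S,j)}=\{\tilde S\in\mathcal{S}:\tilde S_i=S_i,\ 0\le i\le j\}$; the pair $(S,j)$ (identified with $\mathcal{S}_{(S,j)}$) is called a node. Write $\Delta_iS=S_{i+1}-S_i$. A node $(S,j)$ is up-down if $\sup_{\tilde S\in\mathcal{S}_{(S,j)}}(\tilde S_{j+1}-S_j)>0$ and $\inf_{\tilde S\in\mathcal{S}_{(S,j)}}(\tilde S_{j+1}-S_j)<0$; it is flat if both this supremum and this infimum equal $0$; otherwise it is an arbitrage node. An arbitrage node $(S,j)$ is of type I if there is $\hat S\in\mathcal{S}_{(S,j)}$ with $\hat S_{j+1}=S_j$,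 and of type II otherwise. $\mathcal{S}$ is trajectorially complete if for every sequence $(S^n)_{n\ge0}$ in $\mathcal{S}$ with $S^n_i=S^{n+1}_i$ for all $n$ and $0\le i\le n$, the sequence $\overline{S}=(S^i_i)_{i\ge0}$ belongs to $\mathcal{S}$. Portfolios. $\mathcal{H}_{(S,j)}$ is the set of sequences $H=(H_i)_{i\ge j}$ of functions $H_i:\mathcal{S}_{(S,j)}\to\mathbb{R}$ such that $H_i(\tilde S)=H_i(\hat S)$ whenever $\tilde S_k=\hat S_k$ for $j\le k\le i$ (no measurability is required). For $V\in\mathbb{R}$, $H\in\mathcal{H}_{(S,j)}$, $n\ge j$, put $\Pi_{j,n}^{V,H}(\tilde S)=V+\sum_{i=j}^{n-1}H_i(\tilde S)\Delta_i\tilde S$ for $\tilde S\in\mathcal{S}_{(S,j)}$. $\mathcal{E}_{(S,j)}$ is the vector space of all functions $\Pi_{j,n}^{V,H}$ on $\mathcal{S}_{(S,j)}$ ($V\in\mathbb{R}$, $H\in\mathcal{H}_{(S,j)}$, $n$ an integer $\ge j$), and $\mathcal{E}_{(S,j)}^+$ is the set of its nonnegative elements. Null sets. For $f:\mathcal{S}\to[0,\infty]$, $\overline{I}f$ is the infimum of all $\sum_{m\ge1}V^m$ for which there are $H^m\in\mathcal{H}_{(S,0)}$ with $\Pi_{0,n}^{V^m,H^m}\in\mathcal{E}^+_{(S,0)}$ for all $n\ge0$, $m\ge1$, and $f\le\sum_{m\ge1}\liminf_{n\to\infty}\Pi_{0,n}^{V^m,H^m}$ on $\mathcal{S}$ ($\inf\emptyset=\infty$).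 $E\subseteq\mathcal{S}$ is a null set if $\overline{I}(\mathbf{1}_E)=0$. Property $(L_{(S,j)})$: whenever $f=\Pi_{j,n_f}^{V,H}\in\mathcal{E}_{(S,j)}$ and $f_m=\liminf_{n\to\infty}\Pi_{j,n}^{V^m,H^m}$ with $\Pi_{j,n}^{V^m,H^m}\in\mathcal{E}^+_{(S,j)}$ for all $n\ge j$, $m\ge1$, satisfy $f\le\sum_{m\ge1}f_m$ on $\mathcal{S}_{(S,j)}$, then $V\le\sum_{m\ge1}V^m$. Property $(L)$ is $(L_{(S,0)})$ (independent of $S$). Assumption $(L)$-a.e. means: $(L)$ holds, and $\{S\in\mathcal{S}:\exists j\ge0\text{ such that }(L_{(S,j)})\text{ fails}\}$ is a null set. *)

(* Defs.v *)
From HB Require Import structures.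
From mathcomp Require Import all_boot all_order all_algebra.
From mathcomp Require Import all_classical all_reals all_analysis.

Set Implicit Arguments.
Unset Strict Implicit.
Unset Printing Implicit Defensive.

Import Order.TTheory GRing.Theory Num.Theory.

Local Open Scope classical_set_scope.
Local Open Scope ring_scope.

Definition trajectory (R : realType) : Type := nat -> R.

(* Nonemptiness is part of the notion: the root node (S, 0), through which
   property (L) and the operator Ibar are defined, needs some S in SS. *)
Definition trajectory_set (R : realType) (s0 : R) (SS : set (trajectory R)) :
  Prop := SS !=set0 /\ forall S, SS S -> S 0%N = s0.

Definition node (R : realType) (SS : set (trajectory R)) (S : trajectory R)
    (j : nat) : set (trajectory R) :=
  [set T | SS T /\ forall i, (i <= j)%N -> T i = S i].

Definition incr (R : realType) (i : nat) (T : trajectory R) : R :=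
  T i.+1 - T i.

Section NodeTypes.
Variables (R : realType) (SS : set (trajectory R)).
Implicit Types (S T : trajectory R) (j : nat).

(* The supremum and the infimum may be infinite, hence are taken in \bar R. *)
Definition sup_move S j : \bar R :=
  ereal_sup [set (T j.+1 - S j)%:E | T in node SS S j].

Definition inf_move S j : \bar R :=
  ereal_inf [set (T j.+1 - S j)%:E | T in node SS S j].

Definition up_down S j : Prop :=
  (0%E < sup_move S j)%E /\ (inf_move S j < 0%E)%E.

Definition flat S j : Prop := sup_move S j = 0%E /\ inf_move S j = 0%E.

Definition arbitrage S j : Prop := ~ up_down S j /\ ~ flat S j.

Definition arbitrageI S j : Prop :=
  arbitrage S j /\ exists2 T, node SS S j T & T j.+1 = S j.

Definition arbitrageII S j : Prop := arbitrage S j /\ ~ arbitrageI S j.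

Definition trajectorially_complete : Prop :=
  forall F : nat -> trajectory R, (forall n, SS (F n)) ->
    (forall n i, (i <= n)%N -> F n i = F n.+1 i) ->
    SS (fun i => F i i).

End NodeTypes.

(* In this section A stands for the set node SS S j, and j for the time of the
   node. Functions on A are represented by total functions on trajectories, and
   portfolios starting at time j by sequences indexed by all of nat: only the
   values on A and the indices i >= j matter. *)
Section Portfolios.
Variables (R : realType) (A : set (trajectory R)) (j : nat).

Definition portfolio (H : nat -> trajectory R -> R) : Prop :=
  forall i, (j <= i)%N -> forall T U, A T -> A U ->
    (forall k, (j <= k <= i)%N -> T k = U k) -> H i T = H i U.

Definition wealth (V : R) (H : nat -> trajectory R -> R) (n : nat)
    (T : trajectory R) : R :=
  V + \sum_(j <= i < n) H i T * incr i T.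

Definition elementary : set (trajectory R -> R) :=
  [set f | exists V H n, [/\ portfolio H, (j <= n)%N &
                          forall T, A T -> f T = wealth V H n T]].

Definition elementary_pos : set (trajectory R -> R) :=
  [set f | elementary f /\ forall T, A T -> 0 <= f T].

(* A sequence (V m, H m) of initial endowments and portfolios with nonnegative
   wealth at all times. *)
Definition pos_strategies (V : nat -> R)
    (H : nat -> nat -> trajectory R -> R) : Prop :=
  forall m, portfolio (H m) /\
    forall n, (j <= n)%N -> elementary_pos (wealth (V m) (H m) n).

Definition liminf_wealth (V : R) (H : nat -> trajectory R -> R)
    (T : trajectory R) : \bar R :=
  limn_einf (fun n => (wealth V H n T)%:E).

Definition propertyL : Prop :=
  forall (V : R) (H : nat -> trajectory R -> R) (nf : nat)
         (Vs : nat -> R) (Hs : nat -> nat -> trajectory R -> R),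
    portfolio H -> (j <= nf)%N -> pos_strategies Vs Hs ->
    (forall T, A T -> ((wealth V H nf T)%:E <=
       \sum_(0 <= m <oo) liminf_wealth (Vs m) (Hs m) T)%E) ->
    (V%:E <= \sum_(0 <= m <oo) (Vs m)%:E)%E.

End Portfolios.

Section NullSets.
Variables (R : realType) (SS : set (trajectory R)).

(* All nodes at time 0 are equal to SS. *)
Lemma node0 (s0 : R) (S : trajectory R) :
  trajectory_set s0 SS -> SS S -> node SS S 0 = SS.
Proof.
move=> [_ SS0] SSS; apply/seteqP; split => [T []//|T SST]; split => // i.
by rewrite leqn0 => /eqP ->; rewrite !SS0.
Qed.

Definition Ibar (f : trajectory R -> \bar R) : \bar R :=
  ereal_inf [set x | exists V H, [/\ pos_strategies SS 0 V H,
    forall T, SS T ->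
      (f T <= \sum_(0 <= m <oo) liminf_wealth 0 (V m) (H m) T)%E &
    x = (\sum_(0 <= m <oo) (V m)%:E)%E]].

Definition null_set (E : set (trajectory R)) : Prop :=
  E `<=` SS /\ Ibar (fun T => (\1_E T)%:E) = 0%E.

Definition propertyL_at (S : trajectory R) (j : nat) : Prop :=
  propertyL (node SS S j) j.

Definition assumptionL_ae : Prop :=
  propertyL SS 0 /\
  null_set [set S | SS S /\ exists j, ~ propertyL_at S j].

End NullSets.

(* Main.v *)
Require Import Defs.
From HB Require Import structures.
From mathcomp Require Import all_boot all_order all_algebra.
From mathcomp Require Import all_classical all_reals all_analysis.
From mathcomp Require Import lra.
Import Order.TTheory GRing.Theory Num.Theory.
Import numFieldNormedType.Exports.
Local Open Scope classical_set_scope.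
Local Open Scope ring_scope.

Set Implicit Arguments.
Unset Strict Implicit.

(** At an arbitrage node of type II all moves have the same strict sign
    ([arbitrageII_moves]), so betting one unit in that direction whenever such
    a node is met is a portfolio that costs nothing, never loses, and earns a
    positive amount at each of these nodes. Repeating it infinitely often
    produces an infinite terminal gain out of zero capital
    ([arb_strategy_infinite]). Started at a node of type II, this refutes (L)
    there, since it dominates the constant 1; started at time 0, it shows that
    the set of trajectories through such a node is null.

    Conversely, let a node not be of type II, and suppose that strategies of
    total cost less than V dominate an elementary function f of initial value
    V. The hedging surplus, that is the total wealth of the strategies minus
    the wealth of the portfolio defining f, is then at most some -delta < 0 at
    the start. It can be kept negative along a suitable trajectory: from any
    node not of type II there is a move to another such node along which the
    surplus increases by as little as desired ([small_gain_step]). If the node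
    is not up-down, the price can stand still and the surplus does not change.
    If it is up-down, nonnegativity of the wealths after both an up and a down
    move forces the holdings to be absolutely summable ([series_le_affine]), so the increase of the surplus is
    bounded by a linear function of the move, and the assumption on nodes of
    type II provides moves on which that linear function is small. With
    increases summing to at most delta/2, completeness glues the successive
    trajectories together ([trajectory_extension]), and Fatou's lemma for
    series ([nneseries_limn_einf_le]) bounds the sum of the lower limits of the
    wealths by f - delta/2 on the resulting trajectory, contradicting the
    domination of f. *)

(** * Series *)

Lemma limn_einf_ge (R : realType) (u : nat -> \bar R) (N : nat) (c : \bar R) :
  (forall n, (N <= n)%N -> (c <= u n)%E) -> (c <= limn_einf u)%E.
Proof.
move=> cu; rewrite limn_einf_lim; apply: lime_ge; first exact: is_cvg_einfs.
exists N => // n /= Nn; apply: le_ereal_inf_tmp => _ [k /= nk <-].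
exact/cu/(leq_trans Nn).
Qed.

(** Fatou's lemma for the counting measure, in the form of an eventual bound.
    For finite sums the lower limits, being limits of the sequences of infima
    of tails, can be added up; the bound then passes to the series. *)
Lemma nneseries_limn_einf_le (R : realType) (u : nat -> nat -> \bar R)
    (N : nat) (c : \bar R) :
  (forall m n, 0 <= u m n)%E ->
  (forall M n, (N <= n)%N -> (\sum_(0 <= m < M) u m n <= c)%E) ->
  (\sum_(0 <= m <oo) limn_einf (u m) <= c)%E.
Proof.
move=> u0 uc.
have e0 m n : (0 <= einfs (u m) n)%E.
  by apply: le_ereal_inf_tmp => _ [k _ <-]; exact: u0.
have l0 m : (0 <= limn_einf (u m))%E by apply: (limn_einf_ge (N := 0)).
apply: lime_le; first exact: is_cvg_nneseries.
apply: nearW => M.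
under eq_bigr do rewrite limn_einf_lim.
have cvg_sum : (fun n => \sum_(0 <= m < M) einfs (u m) n)%E @ \oo -->
    (\sum_(0 <= m < M) limn (einfs (u m)))%E.
  apply: cvg_nnesum => m _; last exact: is_cvg_einfs.
  exact: nearW (e0 m).
rewrite -(cvg_lim _ cvg_sum) //.
apply: lime_le; first by apply/cvg_ex; eexists; exact: cvg_sum.
exists N => // n /= Nn; apply: le_trans (uc M n Nn).
by apply: lee_sum => m _; apply: ereal_inf_lbound; exists n => /=.
Qed.

(** Here w m and h m are the current wealth and holding of the m-th strategy.
    That every wealth survives a rise by a and a fall by b bounds |h m| by
    (a^-1 + b^-1) * w m, so the holdings have a sum K. Since the terms of the
    sum after a move x are nonnegative, its partial sums are bounded by the
    limit, which is at most c + K * x. *)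
Lemma series_le_affine (R : realType) (w h : nat -> R) (c a b : R) :
  0 < a -> 0 < b ->
  (forall M, \sum_(0 <= m < M) w m <= c) ->
  (forall m, 0 <= w m + h m * a) -> (forall m, 0 <= w m + h m * - b) ->
  exists K, forall x, (forall m, 0 <= w m + h m * x) ->
    forall M, \sum_(0 <= m < M) (w m + h m * x) <= c + K * x.
Proof.
move=> a0 b0 wc wa wb; pose C := a^-1 + b^-1.
have hC m : `|h m| <= C * w m.
  have Ia : 0 < a^-1 by rewrite invr_gt0.
  have Ib : 0 < b^-1 by rewrite invr_gt0.
  have ha : 0 <= a^-1 * w m + h m.
    by have := mulr_ge0 (ltW Ia) (wa m);
      rewrite mulrDr mulrCA mulVf ?gt_eqF// mulr1.
  have hb : 0 <= b^-1 * w m - h m.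
    by have := mulr_ge0 (ltW Ib) (wb m);
      rewrite mulrDr mulrCA mulrN mulVf ?gt_eqF// mulrN1.
  have w0 : 0 <= w m.
    have : 0 <= C * w m by rewrite mulrDl; lra.
    by rewrite pmulr_rge0// addr_gt0.
  have aw : 0 <= a^-1 * w m by rewrite mulr_ge0// ltW.
  have bw : 0 <= b^-1 * w m by rewrite mulr_ge0// ltW.
  by rewrite ler_norml mulrDl; apply/andP; split; lra.
have cvg_h : cvgn (series h).
  apply: normed_cvg; apply: nondecreasing_is_cvgn.
    by apply: nondecreasing_series => m _ _; exact: normr_ge0.
  exists (C * c) => _ [M _ <-]; rewrite /series /=.
  apply: (@le_trans _ _ (C * \sum_(0 <= m < M) w m)).
    by rewrite mulr_sumr; apply: ler_sum => m _; exact: hC.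
  by apply: ler_wpM2l => //; rewrite addr_ge0// invr_ge0 ltW.
exists (limn (series h)) => x xw M.
have cvg_x : (fun N => c + series h N * x) @ \oo --> c + limn (series h) * x.
  by apply: cvgD; [exact: cvg_cst | apply: cvgM => //; exact: cvg_cst].
rewrite -(cvg_lim _ cvg_x) //; apply: limr_ge.
  by apply/cvg_ex; eexists; exact: cvg_x.
exists M => // N /= MN.
apply: (@le_trans _ _ (\sum_(0 <= m < N) (w m + h m * x))).
  by rewrite [leRHS](big_cat_nat (leq0n M) MN) /= lerDl sumr_ge0.
by rewrite big_split /= -mulr_suml lerD2r.
Qed.

(** * Nodes *)

Section Nodes.
Variables (R : realType) (SS : set (trajectory R)).
Implicit Types (S T U : trajectory R) (i j n : nat).

Lemma node_self T n : SS T -> node SS T n T.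
Proof. by []. Qed.

Lemma node_eq T U n : (forall k, (k <= n)%N -> T k = U k) ->
  node SS T n = node SS U n.
Proof.
by move=> TU; apply/seteqP; split => V [SSV VE]; split => // k kn;
  rewrite VE // TU.
Qed.

Lemma node_trans S T U j n : (j <= n)%N -> node SS S j T -> node SS T n U ->
  node SS S j U.
Proof.
move=> jn [_ TS] [SSU UT]; split => // i ij.
by rewrite UT ?TS // (leq_trans ij).
Qed.

Lemma up_downE T n : up_down SS T n <->
  (exists2 U, node SS T n U & T n < U n.+1) /\
  (exists2 U, node SS T n U & U n.+1 < T n).
Proof.
split=> [[/ereal_sup_gt[_ [U TU <-] up] /ereal_inf_lt[_ [D TD <-] dn]]|].
  by split; [exists U | exists D] => //; move: up dn;
    rewrite !lte_fin subr_gt0 subr_lt0.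
move=> [[U TU up] [D TD dn]]; split.
  apply: (@lt_le_trans _ _ (U n.+1 - T n)%:E); first by rewrite lte_fin subr_gt0.
  by apply: ereal_sup_ubound; exists U.
apply: (@le_lt_trans _ _ (D n.+1 - T n)%:E); last by rewrite lte_fin subr_lt0.
by apply: ereal_inf_lbound; exists D.
Qed.

(** A strict up move and a strict down move together would make the node
    up-down, and a zero move would make it of type I. *)
Lemma arbitrageII_moves T n : arbitrageII SS T n ->
  (forall U, node SS T n U -> T n < U n.+1) \/
  (forall U, node SS T n U -> U n.+1 < T n).
Proof.
move=> [arbT notI]; have [nud _] := arbT.
have ne U : node SS T n U -> U n.+1 != T n.
  by move=> TU; apply/eqP => UE; apply: notI; split => //; exists U.
have [ud|/existsNP[D /not_implyP[TD /negP nD]]] :=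
    pselect (forall U, node SS T n U -> T n < U n.+1); first by left.
right=> U TU; rewrite lt_neqAle ne //= leNgt; apply/negP => up.
apply/nud/up_downE; split; first by exists U.
by exists D => //; rewrite lt_neqAle ne //= leNgt.
Qed.

(** At a flat node all moves are 0, and a node of type I has a zero move by
    definition. The two cases are kept exclusive because only a node that is
    not up-down is sure to have no successor of type II. *)
Lemma not_arbitrageII_moves T n : SS T -> ~ arbitrageII SS T n ->
  up_down SS T n \/
  ~ up_down SS T n /\ (exists2 U, node SS T n U & U n.+1 = T n).
Proof.
move=> SST nII; have [ud|nud] := pselect (up_down SS T n); [by left|right].
split=> //; have [[_ mv]|nI] := pselect (arbitrageI SS T n); first by [].
have [[s0 i0]|nfl] := pselect (flat SS T n); last by case: nII.
exists T => //; apply/eqP; rewrite eq_le -subr_le0 -[X in _ && X]subr_ge0.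
rewrite -!lee_fin; apply/andP; split.
  by apply: (@le_trans _ _ (sup_move SS T n)); [apply: ereal_sup_ubound; exists T
    | rewrite s0].
by apply: (@le_trans _ _ (inf_move SS T n)); [rewrite i0
  | apply: ereal_inf_lbound; exists T].
Qed.

(** * Portfolios and their wealth *)

Section Wealth.
Variables (A : set (trajectory R)) (j : nat).
Implicit Types (V : R) (H : nat -> trajectory R -> R).

Lemma wealth_start V H T n : (n <= j)%N -> wealth j V H n T = V.
Proof. by move=> nj; rewrite /wealth big_geq // addr0. Qed.

Lemma wealthS V H T n : (j <= n)%N ->
  wealth j V H n.+1 T = wealth j V H n T + H n T * incr n T.
Proof. by move=> jn; rewrite /wealth big_nat_recr //= addrA. Qed.

Lemma wealth_eq V H T U n : portfolio A j H -> A T -> A U ->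
  (forall k, (k <= n)%N -> T k = U k) -> wealth j V H n T = wealth j V H n U.
Proof.
move=> pH AT AU TU; rewrite /wealth; congr (_ + _).
apply: eq_big_nat => i /andP[ji i_n]; rewrite /incr !TU ?(ltnW i_n) //.
congr (_ * _); apply: pH => // k /andP[_ ki].
by rewrite TU // (leq_trans ki) // ltnW.
Qed.

(** Positivity is required from time j on only; before, the wealth is the
    initial endowment, which is also the wealth at time j. *)
Lemma pos_strategies_ge0 (Vs : nat -> R)
    (Hs : nat -> nat -> trajectory R -> R) T n m :
  pos_strategies A j Vs Hs -> A T -> 0 <= wealth j (Vs m) (Hs m) n T.
Proof.
move=> /(_ m)[_ pos] AT; have [jn|/ltnW nj] := leqP j n.
  by have [_ ] := pos n jn; apply.
rewrite wealth_start //; have [_ /(_ T AT)] := pos j (leqnn j).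
by rewrite wealth_start.
Qed.

End Wealth.

(** * Exploiting the nodes of type II *)

(** The tests only depend on the node of T at time i, which makes this
    strategy nonanticipating. *)
Definition arb_strategy i T : R :=
  if `[< forall U, node SS T i U -> T i < U i.+1 >] then 1
  else if `[< forall U, node SS T i U -> U i.+1 < T i >] then -1 else 0.

Lemma arb_strategy_portfolio S j : portfolio (node SS S j) j arb_strategy.
Proof.
move=> i ji T U [SST TS] [SSU US] TU.
have {}TU k : (k <= i)%N -> T k = U k.
  move=> ki; have [jk|/ltnW kj] := leqP j k; first by apply: TU; rewrite jk.
  by rewrite TS // US.
by rewrite /arb_strategy (node_eq TU) TU.
Qed.

Lemma arb_strategy_gain_ge0 i T : SS T -> 0 <= arb_strategy i T * incr i T.
Proof.
move=> SST; rewrite /arb_strategy /incr.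
case: asboolP => [/(_ T (node_self i SST)) up|_].
  by rewrite mul1r subr_ge0 ltW.
case: asboolP => [/(_ T (node_self i SST)) dn|_]; last by rewrite mul0r.
by rewrite mulN1r oppr_ge0 subr_le0 ltW.
Qed.

Lemma arb_strategy_gain_gt0 i T : SS T -> arbitrageII SS T i ->
  0 < arb_strategy i T * incr i T.
Proof.
move=> SST /arbitrageII_moves II; rewrite /arb_strategy /incr.
case: asboolP => [/(_ T (node_self i SST)) up|nup].
  by rewrite mul1r subr_gt0.
case: asboolP => [/(_ T (node_self i SST)) dn|ndn].
  by rewrite mulN1r oppr_gt0 subr_lt0.
by case: II.
Qed.

Lemma arb_strategy_pos S j :
  pos_strategies (node SS S j) j (fun=> 0) (fun=> arb_strategy).
Proof.
move=> m; split; first exact: arb_strategy_portfolio.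
move=> n jn; split.
  by exists 0, arb_strategy, n; split => //; exact: arb_strategy_portfolio.
move=> T [SST _]; rewrite /wealth add0r sumr_ge0 // => i _.
exact: arb_strategy_gain_ge0.
Qed.

(** Gains are never lost again, so each copy of the strategy ends up with at
    least the gain made at time n, and there are infinitely many copies. *)
Lemma arb_strategy_infinite T j n : SS T -> (j <= n)%N -> arbitrageII SS T n ->
  (\sum_(0 <= m <oo) liminf_wealth j 0 arb_strategy T = +oo :> \bar R)%E.
Proof.
move=> SST jn II; pose g := arb_strategy n T * incr n T.
have g0 : 0 < g by exact: arb_strategy_gain_gt0.
have gl : (g%:E <= liminf_wealth j 0 arb_strategy T)%E.
  apply: (limn_einf_ge (N := n.+1)) => l nl.
  rewrite lee_fin /wealth add0r (big_cat_nat _ nl) /=; last exact: leqW.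
  rewrite big_nat_recr //= -addrA addrCA lerDl addr_ge0 // sumr_ge0 // => i _;
    exact: arb_strategy_gain_ge0.
apply: eq_infty => r; pose M := (Num.truncn (r / g)).+1.
have rM : r <= \sum_(0 <= m < M) g.
  rewrite big_const_nat subn0 iter_addr_0 -[g *+ M]mulr_natl -ler_pdivrMr //.
  exact/ltW/truncnS_gt.
apply: le_trans (nneseries_lim_ge M _) => [|m _ _]; last first.
  by apply: le_trans gl; rewrite lee_fin ltW.
apply: (@le_trans _ _ (\sum_(0 <= m < M) g%:E)%E).
  by rewrite sumEFin lee_fin.
by apply: lee_sum.
Qed.

Lemma arbitrageII_not_propertyL S j : SS S -> arbitrageII SS S j ->
  ~ propertyL_at SS S j.
Proof.
move=> SSS II L.
(* The constant 1 is the wealth of the zero portfolio with endowment 1. *)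
have pf0 : portfolio (node SS S j) j (fun _ _ => 0 : R) by [].
have := L 1 (fun _ _ => 0) j (fun=> 0) (fun=> arb_strategy) pf0 (leqnn j)
  (arb_strategy_pos S j).
rewrite eseries0 // lee_fin ler10; apply/not_implyP; split => //.
move=> T [SST TS]; rewrite (@arb_strategy_infinite T j j) ?leey //.
by move: II; rewrite /arbitrageII /arbitrageI /arbitrage /up_down /flat
  /sup_move /inf_move (node_eq TS) TS.
Qed.

(** * Property (L) away from the nodes of type II *)

Definition arbitrageII_flanked : Prop :=
  forall S j, SS S -> arbitrageII SS S j ->
    [/\ (1 <= j)%N, up_down SS S j.-1 &
      forall eps : R, 0 < eps ->
      exists S1 S2 : trajectory R,
        [/\ node SS S j.-1 S1 /\ node SS S j.-1 S2,
            - eps <= S1 j - S j.-1,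
            S2 j - S j.-1 <= eps,
            ~ arbitrageII SS S1 j & ~ arbitrageII SS S2 j]].

Hypothesis flanked : arbitrageII_flanked.

(** If some successor is of type II, these moves are what the assumption
    grants; otherwise any up move and any down move will do. *)
Lemma up_down_small_moves T n (eta : R) : SS T -> up_down SS T n -> 0 < eta ->
  (exists U, [/\ node SS T n U, - eta <= U n.+1 - T n &
     ~ arbitrageII SS U n.+1]) /\
  (exists U, [/\ node SS T n U, U n.+1 - T n <= eta &
     ~ arbitrageII SS U n.+1]).
Proof.
move=> SST ud eta0.
have [[V [[SSV VT] IIV]]|noII] :=
    pselect (exists V, node SS T n V /\ arbitrageII SS V n.+1).
  have [_ _ /(_ eta eta0)[U1 [U2]]] := flanked SSV IIV.
  rewrite /= (node_eq VT) VT // => -[[TU1 TU2] up dn n1 n2].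
  by split; [exists U1 | exists U2].
have safe U : node SS T n U -> ~ arbitrageII SS U n.+1.
  by move=> TU II; apply: noII; exists U.
have [[U TU up] [D TD dn]] := (up_downE T n).1 ud.
split; [exists U | exists D]; split => //; try exact: safe; lra.
Qed.

(** Here k is the holding of the portfolio to be dominated, so that the
    surplus of the wealths w over that portfolio grows by at most eps. At a node
    that is not up-down a zero move is safe, since the predecessor of a node of
    type II is up-down. *)
Lemma small_gain_step T n (w h : nat -> R) (c k eps : R) : SS T ->
  ~ arbitrageII SS T n ->
  (forall U m, node SS T n U -> 0 <= w m + h m * (U n.+1 - T n)) ->
  (forall M, \sum_(0 <= m < M) w m <= c) -> 0 < eps ->
  exists U, [/\ node SS T n U, ~ arbitrageII SS U n.+1 &
    forall M, \sum_(0 <= m < M) (w m + h m * (U n.+1 - T n)) <=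
      c + k * (U n.+1 - T n) + eps].
Proof.
move=> SST nII wh wc eps0.
have [ud|[nud [U TU U0]]] := not_arbitrageII_moves SST nII; last first.
  exists U; split => //.
    move=> II; have [_ + _] := flanked TU.1 II.
    rewrite /= /up_down /sup_move /inf_move.
    by case: TU => _ TU; rewrite (node_eq TU) TU.
  move=> M; rewrite U0 subrr mulr0 addr0 -[leLHS]addr0.
  apply: lerD (ltW eps0); under eq_bigr do rewrite mulr0 addr0.
  exact: wc.
have [[U TU up] [D TD dn]] := (up_downE T n).1 ud.
have up0 : 0 < U n.+1 - T n by rewrite subr_gt0.
have dn0 : 0 < T n - D n.+1 by rewrite subr_gt0.
have wdn m : 0 <= w m + h m * - (T n - D n.+1) by rewrite opprB; exact: wh.
have [K sumK] := series_le_affine up0 dn0 wc (fun m => wh U m TU) wdn.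
suff [V [TV small nIIV]] : exists V, [/\ node SS T n V,
    (K - k) * (V n.+1 - T n) <= eps & ~ arbitrageII SS V n.+1].
  exists V; split => // M; apply: (le_trans (sumK _ (fun m => wh V m TV) M)).
  by rewrite -addrA lerD2l -lerBlDl -mulrBl.
(* The sign of K - k decides on which side moves have to be small; adding 1
   avoids a division by 0. *)
pose eta := eps / (`|K - k| + 1).
have d0 : 0 < `|K - k| + 1 by rewrite ltr_pwDr.
have eta0 : 0 < eta by rewrite divr_gt0.
have etaE : `|K - k| * eta <= eps.
  by rewrite mulrCA ger_pMr // ler_pdivrMr // mul1r lerDl.
have [[V1 [TV1 up1 n1]] [V2 [TV2 dn2 n2]]] := up_down_small_moves SST ud eta0.
have [Kk|/ltW Kk] := leP 0 (K - k).
  exists V2; split => //; apply: le_trans etaE.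
  by rewrite (ger0_norm Kk) ler_wpM2l.
exists V1; split => //; apply: le_trans etaE.
by rewrite (ler0_norm Kk) mulNr -mulrN; exact: ler_wnM2l.
Qed.

Hypothesis complete : trajectorially_complete SS.

(** Dependent choice along the tree of nodes, followed by a passage to the
    diagonal. Q n may look beyond time n, where the diagonal T need not agree
    with the trajectory constructed at that stage; so Q n is asserted of the
    latter, which shares the past of T up to time n. *)
Lemma trajectory_extension (Q : nat -> trajectory R -> Prop) S j :
  (forall n T, (j <= n)%N -> SS T -> Q n T ->
     exists2 U, node SS T n U & Q n.+1 U) ->
  SS S -> Q j S ->
  exists2 T, node SS S j T & forall n, (j <= n)%N -> exists2 U,
    node SS T n U & Q n U.
Proof.
move=> ext SSS QS.
have /choice[f fP] (nT : nat * trajectory R) : exists U,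
    (j <= nT.1)%N -> SS nT.2 -> Q nT.1 nT.2 ->
    node SS nT.2 nT.1 U /\ Q nT.1.+1 U.
  have [jn|/negP jn] := boolP (j <= nT.1)%N; last by exists S.
  have [[SST QT]|no] := pselect (SS nT.2 /\ Q nT.1 nT.2); last first.
    by exists S => _ ? ?; case: no.
  by have [U] := ext _ _ jn SST QT; exists U.
pose G := fix G k := if k is k'.+1 then f ((j + k')%N, G k') else S.
have GP k : SS (G k) /\ Q (j + k)%N (G k).
  elim: k => [|k [SSG QG]]; first by rewrite addn0.
  rewrite addnS /=.
  by have [[SSU _] QU] := fP ((j + k)%N, G k) (leq_addr _ _) SSG QG.
have GS k i : (i <= j + k)%N -> G k.+1 i = G k i.
  move=> ijk; have [SSG QG] := GP k.
  by have [[_ fE] _] := fP ((j + k)%N, G k) (leq_addr _ _) SSG QG; exact: fE.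
have GD k l i : (i <= j + k)%N -> G (k + l)%N i = G k i.
  move=> ijk; elim: l => [|l IH]; first by rewrite addn0.
  by rewrite addnS GS ?IH // (leq_trans ijk) // leq_add2l leq_addr.
(* G k is settled up to time j + k, so the diagonal agrees with it until then;
   shifting by j makes the truncated subtraction freeze G at S before time j. *)
pose T i := G (i - j)%N i.
have TG k i : (i <= j + k)%N -> T i = G k i.
  move=> ijk; rewrite /T.
  have ik : (i - j <= k)%N by rewrite leq_subLR.
  have := @GD (i - j)%N (k - (i - j))%N i; rewrite (subnKC ik) => -> //.
  by rewrite -leq_subLR.
have SST : SS T.
  apply: (complete (F := fun n => G (n - j)%N)) => [n|n i i_n].
    by have [] := GP (n - j)%N.
  have [jn|nj] := leqP j n; first by rewrite subSn // GS // subnKC.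
  have /eqP -> : (n - j == 0)%N by rewrite subn_eq0 ltnW.
  by have /eqP -> : (n.+1 - j == 0)%N by rewrite subn_eq0.
exists T; first by split => // i ij; rewrite (TG 0%N) // addn0.
move=> n jn; have [SSG QG] := GP (n - j)%N; rewrite subnKC // in QG.
by exists (G (n - j)%N) => //; split => // i i_n;
  rewrite (TG (n - j)%N) // subnKC.
Qed.

(** The surplus is kept at most -delta * (1/2 + 1/2^(k+1)) after k steps: it is
    -delta or less at first, and step k, counted from 0, may increase it by
    delta/2^(k+2). *)
Lemma not_arbitrageII_propertyL S j : SS S -> ~ arbitrageII SS S j ->
  propertyL_at SS S j.
Proof.
move=> SSS nII V H nf Vs Hs pH jnf posHs fle.
have AS : node SS S j S by exact: node_self.
have Vs0 m : 0 <= Vs m.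
  by have := pos_strategies_ge0 j m posHs AS; rewrite wealth_start.
have Vs0E m : (0 <= (Vs m)%:E)%E by rewrite lee_fin.
rewrite leNgt; apply/negP => ltV.
have sum_fin : (\sum_(0 <= m <oo) (Vs m)%:E)%E \is a fin_num.
  rewrite ge0_fin_numE; first exact: lt_trans ltV (ltry _).
  by apply: nneseries_ge0 => m _ _.
move: ltV; rewrite -(fineK sum_fin) lte_fin => ltV.
pose delta := V - fine (\sum_(0 <= m <oo) (Vs m)%:E)%E.
have delta0 : 0 < delta by rewrite subr_gt0.
(* Stopping the portfolio at nf lets its wealth be compared at all later
   times. *)
pose Ht i T := if (i < nf)%N then H i T else 0.
have pHt : portfolio (node SS S j) j Ht.
  by move=> i ji T U AT AU TU; rewrite /Ht; case: ifP => // _; exact: pH.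
have HtE n T : (nf <= n)%N -> wealth j V Ht n T = wealth j V H nf T.
  move=> nfn; rewrite /wealth (big_cat_nat jnf nfn) /=; congr (_ + _).
  rewrite [X in _ + X]big1_seq ?addr0 => [|i].
    by apply: eq_big_nat => i /andP[_ i_nf]; rewrite /Ht i_nf.
  rewrite mem_index_iota => /andP[_ /andP[nfi _]].
  by rewrite /Ht ltnNge nfi mul0r.
pose Q n T := [/\ node SS S j T, ~ arbitrageII SS T n & forall M,
  \sum_(0 <= m < M) wealth j (Vs m) (Hs m) n T <=
    wealth j V Ht n T - delta * (2^-1 + 2^-1 ^+ (n - j).+1)].
have QS : Q j S.
  split => // M; rewrite wealth_start // subnn expr1.
  have -> : 2^-1 + 2^-1 = 1 :> R by lra.
  rewrite mulr1 /delta opprB addrC subrK.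
  under eq_bigr do rewrite wealth_start //.
  rewrite -lee_fin (fineK sum_fin) -sumEFin.
  by apply: nneseries_lim_ge => m _ _.
have Qext n T : (j <= n)%N -> SS T -> Q n T ->
    exists2 U, node SS T n U & Q n.+1 U.
  move=> jn SST [AT nIIT sumT].
  have moveE W K U : portfolio (node SS S j) j K -> node SS T n U ->
      wealth j W K n.+1 U = wealth j W K n T + K n T * (U n.+1 - T n).
    move=> pK TU; have AU := node_trans jn AT TU; case: TU => _ TU.
    rewrite wealthS // (wealth_eq _ pK AU AT TU) /incr (TU n) //.
    congr (_ + _ * _); apply: pK => // k /andP[_]; exact: TU.
  have eps0 : 0 < delta * 2^-1 ^+ (n - j).+2.
    by rewrite mulr_gt0 // exprn_gt0.
  have [|U [TU nIIU sumU]] := @small_gain_step T n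
      (fun m => wealth j (Vs m) (Hs m) n T) (fun m => Hs m n T) _ (Ht n T) _
      SST nIIT _ sumT eps0.
    move=> U m TU; rewrite -moveE //; last by have [] := posHs m.
    exact: pos_strategies_ge0 (node_trans jn AT TU).
  exists U => //; split => // [|M]; first exact: node_trans TU.
  under eq_bigr => m _.
    rewrite moveE //; first over.
    by have [] := posHs m.
  apply: le_trans (sumU M) _.
  rewrite moveE // subSn // [_ ^+ (n - j).+2]exprS.
  lra.
have [T AT QT] := trajectory_extension Qext SSS QS.
have := fle T AT; apply/negP; rewrite -ltNge.
apply: (@le_lt_trans _ _ (wealth j V H nf T - delta / 2)%:E); last first.
  by rewrite lte_fin ltrBlDr ltrDl divr_gt0.
apply: (@nneseries_limn_einf_le _ _ nf) => [m n|M n nfn].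
  by rewrite lee_fin; exact: pos_strategies_ge0 AT.
have jn := leq_trans jnf nfn.
have [U [_ UT] [AU _ sumU]] := QT n jn.
rewrite sumEFin lee_fin.
under eq_bigr => m _.
  rewrite (@wealth_eq _ j _ _ _ U _ _ AT AU); first over.
    by have [] := posHs m.
  by move=> k kn; rewrite UT.
apply: le_trans (sumU M) _; rewrite HtE //.
rewrite (@wealth_eq _ j _ _ U T _ pH AU AT) => [|k knf]; last first.
  by rewrite UT // (leq_trans knf).
by rewrite lerD2l lerN2 mulrDr lerDl mulr_ge0 ?ltW // exprn_gt0.
Qed.

Lemma propertyL_atE S j : SS S -> ~ propertyL_at SS S j <-> arbitrageII SS S j.
Proof.
move=> SSS; split; last exact: arbitrageII_not_propertyL.
by move=> nL; apply: contrapT => /(not_arbitrageII_propertyL SSS).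
Qed.

End Nodes.

(** * Null sets *)

Lemma Ibar_ge0 (R : realType) (SS : set (trajectory R))
  (f : trajectory R -> \bar R) : SS !=set0 -> (0 <= Ibar SS f)%E.
Proof.
move=> [T SST]; apply: le_ereal_inf_tmp => _ [V [H [posH _ ->]]].
apply: nneseries_ge0 => m _ _; rewrite lee_fin.
by have := pos_strategies_ge0 0 m posH SST; rewrite wealth_start.
Qed.

Lemma null_arbitrageII (R : realType) (s0 : R) (SS : set (trajectory R)) :
  trajectory_set s0 SS ->
  Defs.null_set SS [set S | SS S /\ exists j, arbitrageII SS S j].
Proof.
move=> hSS; have [[S0 SS0] _] := hSS.
split=> [S []//|]; apply/eqP; rewrite eq_le Ibar_ge0 ?andbT; last by exists S0.
have pos : pos_strategies SS 0 (fun=> 0) (fun=> arb_strategy SS).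
  by have := @arb_strategy_pos _ SS S0 0; rewrite (node0 hSS).
apply: ereal_inf_lbound; exists (fun=> 0), (fun=> arb_strategy SS); split => //.
- move=> T SST; rewrite indicE; have [/set_mem[_ [j II]]|_] := boolP (T \in _).
    by rewrite (@arb_strategy_infinite _ _ _ 0 j) ?leey.
  apply: nneseries_ge0 => m _ _; apply: (limn_einf_ge (N := 0)) => k _.
  by rewrite lee_fin (pos_strategies_ge0 _ m pos).
- by rewrite eseries0.
Qed.

Unset Implicit Arguments.

Theorem theorem7p1 (R : realType) (s0 : R) (SS : set (trajectory R))
  (hSS : trajectory_set s0 SS)
  (hcomplete : trajectorially_complete SS)
  (hII : forall (S : trajectory R) (j : nat), SS S -> arbitrageII SS S j ->
     [/\ (1 <= j)%N, up_down SS S j.-1 &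
      forall eps : R, 0 < eps ->
      exists S1 S2 : trajectory R,
        [/\ node SS S j.-1 S1 /\ node SS S j.-1 S2,
            - eps <= S1 j - S j.-1,
            S2 j - S j.-1 <= eps,
            ~ arbitrageII SS S1 j & ~ arbitrageII SS S2 j]]) :
  assumptionL_ae SS /\
  (forall (S : trajectory R) (j : nat), SS S ->
     (~ propertyL_at SS S j <-> arbitrageII SS S j)).
Proof.
have LE := @propertyL_atE R SS hII hcomplete.
split=> //; split.
  have [[S SSS] _] := hSS.
  rewrite -(node0 hSS SSS).
  apply: (not_arbitrageII_propertyL hII hcomplete SSS) => II.
  by have [] := hII S 0 SSS II.
rewrite (_ : [set _ | _] = [set S | SS S /\ exists j, arbitrageII SS S j]).
  exact: null_arbitrageII hSS.
by apply/seteqP; split => S [SSS [j bad]]; split => //; exists j; apply/LE.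
Qed.
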